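(* Let $k\geq 5$ be an integer. Suppose there exists an integer $m_0\geq 0$ such that $D_{k,m_0}(q)$ is unimodal and such that, for all integers $m$ with $m_0<m<8k^{3/2}$ and all integers $n$ with $\left\lceil\frac{k(k-1)m^2}{4}\right\rceil\leq n\leq\left\lfloor\frac{k(k-1)(m+1)^2}{4}\right\rfloor$, $$d_{k,m}(n)\geq d_{k,m}(n-1).$$ Then $D_{k,m}(q)$ is unimodal for every integer $m\geq m_0$.
   Context: For integers $k\geq 1$ and $m\geq 0$, put $$D_{k,m}(q)=\prod_{j=0}^m \left(1+q^{kj+1}\right)\left(1+q^{kj+2}\right)\cdots\left(1+q^{kj+k-1}\right)=\sum_{n=0}^{N(k,m)}d_{k,m}(n)q^n,\qquad N(k,m)=\frac{k(k-1)(m+1)^2}{2}.$$ Equivalently, $d_{k,m}(n)$ is the number of partitions of $n$ into distinct parts, none divisible by $k$, with largest part at most $km+k-1$. A polynomial $a_0+a_1q+\cdots+a_Nq^N$ with integer coefficients is called unimodal if for some $0\leq j\leq N$ one has $a_0\leq a_1\leq\cdots\leq a_j\geq a_{j+1}\geq\cdots\geq a_N$. *)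

(* Defs.v *)
From HB Require Import structures.
From mathcomp Require Import all_boot all_order all_algebra.
From mathcomp Require Import reals exp.
From mathcomp Require Import zify.

Set Implicit Arguments.
Unset Strict Implicit.
Unset Printing Implicit Defensive.

Import Order.TTheory GRing.Theory Num.Theory.
Local Open Scope ring_scope.

Definition D (k m : nat) : {poly int} :=
  \prod_(0 <= j < m.+1) \prod_(1 <= i < k) (1 + 'X^(k * j + i)).

Definition d (k m n : nat) : int := (D k m)`_n.

(* The top index N is the degree of p; for D k m with 0 < k this is
   k(k-1)(m+1)^2/2, see size_D. *)
Definition unimodal (p : {poly int}) : Prop :=
  exists j : nat,
    [/\ (j <= (size p).-1)%N,
        (forall i : nat, (i < j)%N -> p`_i <= p`_i.+1) &
        (forall i : nat, (j <= i < (size p).-1)%N -> p`_i.+1 <= p`_i)].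

Lemma size_D (k m : nat) : (0 < k)%N ->
  size (D k m) = ((k * k.-1 * m.+1 ^ 2) %/ 2).+1.
Proof.
case: k => // l _.
have szf (n : nat) : size (1 + 'X^(n.+1) : {poly int}) = n.+2.
  by rewrite addrC size_polyDl size_polyXn // size_poly1.
have inner (j r : nat) :
    (size (\prod_(1 <= i < r.+1) (1 + 'X^(l.+1 * j + i)) : {poly int})).*2 =
    (r * r.+1 + (l.+1 * j * r).*2).+2%N.
  elim: r => [|r IH]; first by rewrite big_geq // size_poly1 muln0.
  rewrite big_nat_recr //= addnS size_mul -?size_poly_eq0 ?szf //.
    by move: IH; set a := size _; nia.
  by apply/eqP => /= E; move: IH; rewrite E.
have outer : (size (D l.+1 m)).*2 = (l.+1 * l * m.+1 ^ 2).+2.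
  elim: m => [|m IH]; first by rewrite /D big_nat1 inner; lia.
  have Im := inner m.+1 l.
  rewrite /D big_nat_recr //= -/(D _ _) size_mul -?size_poly_eq0.
  - move: IH Im; set a := size _; set b := size _; nia.
  - by apply/eqP => E; move: IH; rewrite E.
  - by apply/eqP => E; move: Im; rewrite E.
by rewrite -[LHS]doubleK outer -divn2 /= -add2n divnDl // divnn.
Qed.

(* Main.v *)
Require Import Defs.
From HB Require Import structures.
From mathcomp Require Import all_boot all_order all_algebra.
From mathcomp Require Import reals exp.
From mathcomp Require Import topology normedtype sequences derive trigo.
From mathcomp Require Import ring lra zify.

(** Let [N] be the degree of [D k m], [P] the number of allowed parts, [C t] the
    product of the [cos (r t)] over these parts [r], and [mu = N + 1 - 2 n]. Discrete
    Fourier inversion on a grid of [M > N] points of [[-pi/2, pi/2]] gives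
    [M (d n - d (n-1)) = 2 ^ (P + 1) * \sum_t C t * sin (mu t) * sin t].
    Put [s = k (m+1) ^ 2]. The summand is at least [mu / (8 s ^ 2)] for [t] between
    [pi / (4 s)] and [pi / (2 s)], and it is never below [- mu / (32 s ^ 3)] when
    [(m+1) ^ 2 >= 64 k ^ 3]: where [sin (mu t)] may be negative, [C t] is tiny, by
    [cos x <= exp (- x ^ 2 / 2)] as long as [k (m+1) t <= 3/2], and beyond that by
    [cos x ^ 2 <= exp (- sin x ^ 2)] together with bounds on Dirichlet kernels.
    Hence [d (n-1) <= d n] on the window of indices between the centres of
    [D k (m-1)] and [D k m]. Below the centre of [D k (m-1)] the coefficients of
    [D k m] increase because those of [D k (m-1)] do, and symmetry does the rest. *)

Set Implicit Arguments.
Unset Strict Implicit.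
Unset Printing Implicit Defensive.

Import Order.TTheory GRing.Theory Num.Theory.
Import numFieldNormedType.Exports.
Local Open Scope ring_scope.

Section SineCosineExponential.
Variable R : realType.
Implicit Types (a t x y : R) (n : nat).

Lemma is_derive_ler (f g df dg : R -> R) a x :
  (forall y, is_derive y 1 f (df y)) -> (forall y, is_derive y 1 g (dg y)) ->
  {in `[a, x], forall y, df y <= dg y} -> f a <= g a -> a <= x -> f x <= g x.
Proof.
move=> f' g' le_df_dg le_fga le_ax.
have gf' y : is_derive y 1 (fun z => g z - f z) (dg y - df y) by exact: is_deriveB.
have [|c /le_df_dg le_c] := MVT_segment le_ax (fun y _ => gf' y).
  apply: continuous_subspaceT => y.
  exact/differentiable_continuous/derivable1_diffP/(@ex_derive _ _ _ _ _ _ _ (gf' y)).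
have : 0 <= (dg c - df c) * (x - a) by rewrite mulr_ge0 ?subr_ge0.
lra.
Qed.

Lemma sin_le x : 0 <= x -> sin x <= x.
Proof.
apply: (@is_derive_ler sin id cos (fun=> 1)) => [y _|]; first exact: cos_le1.
by rewrite sin0.
Qed.

Lemma cos_ge_quadratic x : 1 - x ^+ 2 / 2 <= cos x.
Proof.
rewrite -cos_norm -(real_normK (num_real x)).
apply: (@is_derive_ler (fun y => 1 - y ^+ 2 / 2) cos (fun y => - y)
  (fun y => - sin y) 0 `|x|) => //.
- by move=> y; apply: is_derive_eq; rewrite /GRing.scale/=; lra.
- by move=> y; rewrite in_itv/= lerN2 => /andP[y0 _]; exact: sin_le.
- by rewrite cos0; lra.
Qed.

Lemma sin_ge_cubic x : 0 <= x -> x - x ^+ 3 / 6 <= sin x.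
Proof.
apply: (@is_derive_ler (fun y => y - y ^+ 3 / 6) sin
  (fun y => 1 - y ^+ 2 / 2) cos) => //.
- by move=> y; apply: is_derive_eq; rewrite /GRing.scale/=; lra.
- by move=> y _; exact: cos_ge_quadratic.
- by rewrite sin0; lra.
Qed.

Lemma sin_ge_linear x : 0 <= x <= 1 -> 5 / 6 * x <= sin x.
Proof.
move=> /andP[x0 x1]; apply: le_trans (sin_ge_cubic x0).
have : 0 <= x * (1 - x ^+ 2) by rewrite mulr_ge0// subr_ge0 exprn_ile1.
lra.
Qed.

Lemma mulr_cos_le_sin x : 0 <= x <= pi -> x * cos x <= sin x.
Proof.
move=> /andP[x0 xpi]; move: x0.
apply: (@is_derive_ler (fun y => y * cos y) sin
  (fun y => cos y - y * sin y) cos) => //.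
- by move=> y; apply: is_derive_eq; rewrite /GRing.scale/=; lra.
- move=> y; rewrite in_itv/= => /andP[y0 yx].
  by rewrite lerBlDr lerDl mulr_ge0// sin_ge0_pi// y0 (le_trans yx).
- by rewrite mul0r sin0.
Qed.

(* The derivative of [cos y * expR (y ^+ 2 / 2)] has the sign of
   [y * cos y - sin y]. *)
Lemma cos_le_gauss x : 0 <= x <= pi -> cos x <= expR (- (x ^+ 2 / 2)).
Proof.
move=> /andP[x0 xpi]; rewrite expRN -[leRHS]mul1r ler_pdivlMr ?expR_gt0//.
apply: (@is_derive_ler (fun y => cos y * expR (y ^+ 2 / 2)) (fun=> 1)
  (fun y => (y * cos y - sin y) * expR (y ^+ 2 / 2)) (fun=> 0) 0 x) => //.
- move=> y; have dexp : is_derive y 1 (fun z => expR (z ^+ 2 / 2)) (y * expR (y ^+ 2 / 2)).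
    apply: is_derive_eq.
    by rewrite /GRing.scale/=; lra.
  by apply: is_derive_eq; rewrite /GRing.scale/=; ring.
- move=> y; rewrite in_itv/= => /andP[y0 yx].
  rewrite mulr_le0_ge0 ?expR_ge0// subr_le0 mulr_cos_le_sin// y0.
  exact: le_trans xpi.
- by rewrite cos0 expr0n/= mul0r expR0 mulr1.
Qed.

Lemma cos_mul2 x : cos (2 * x) = 1 - 2 * sin x ^+ 2.
Proof. by rewrite mulr_natl cos_mulr2n cos2sin2 -mulr_natr; ring. Qed.

Lemma norm_cos_le_expR x : `|cos x| <= expR (- (sin x ^+ 2 / 2)).
Proof.
rewrite -(@ler_pXn2r _ 2)// ?nnegrE ?expR_ge0//.
rewrite real_normK ?num_real// cos2sin2 -expRM_natl.
have -> : 2 * - (sin x ^+ 2 / 2) = - (sin x ^+ 2) by lra.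
exact: expR_ge1Dx.
Qed.

Lemma norm_sin_natmul_le n x : `|sin (n%:R * x)| <= n%:R * `|sin x|.
Proof.
elim: n => [|n IH]; first by rewrite !mul0r sin0 normr0.
rewrite -natr1 !mulrDl !mul1r sinD (le_trans (ler_normD _ _))// lerD//.
- by rewrite normrM (le_trans _ IH)// ler_piMr// cos_max.
- by rewrite normrM ler_piMl// cos_max.
Qed.

Lemma pi_ge3 : 3 <= pi :> R.
Proof.
have cos_gt0 : 0 < cos (3 / 2) :> R.
  have -> : 3 / 2 = (3 / 4) *+ 2 :> R by lra.
  by rewrite cos_mulr2n; have := cos_ge_quadratic (3 / 4 : R); nra.
have : ~~ (pi / 2 <= 3 / 2 :> R); last by rewrite -ltNge; lra.
have [pi2 pi4] := (pi_ge2 R, pihalf_lt2 R).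
apply/negP => le_pi3; move: cos_gt0; apply/negP; rewrite -leNgt -(cos_pihalf R).
by rewrite leNgt ltr_cos -?leNgt ?in_itv//=; apply/andP; split; lra.
Qed.

Lemma sin_ge_cubic_of_le x y : 0 <= x <= y -> y <= pi / 2 ->
  x - x ^+ 3 / 6 <= sin y.
Proof.
move=> /andP[x0 xy] ypi; apply: (le_trans (sin_ge_cubic x0)).
have := pi_gt0 R => pi0.
by rewrite leNgt ltr_sin -?leNgt ?in_itv//=; apply/andP; split; lra.
Qed.

Lemma sinD_natmul_2pi x n : sin (x + 2 * n%:R * pi) = sin x.
Proof.
by rewrite [2 * _]mulrC -mulrA !mulr_natl; apply/periodicn/sinD2pi.
Qed.

Lemma expRN_natr_le n x : n%:R <= x -> expR (- x) <= (2 / 5) ^+ n.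
Proof.
move=> le_nx; apply: (@le_trans _ _ (expR (- 1) ^+ n)).
  by rewrite -expRM_natl ler_expR mulrN1 lerN2.
rewrite lerXn2r ?nnegrE ?expR_ge0 ?divr_ge0//.
rewrite expRN -invf_div lef_pV2 ?posrE ?expR_gt0 ?divr_gt0//.
have -> : 1 = 8%:R * 8^-1 :> R by lra.
rewrite expRM_natl; apply: (@le_trans _ _ ((1 + 8^-1) ^+ 8)); first lra.
by rewrite lerXn2r ?nnegrE ?expR_ge0 ?addr_ge0 ?invr_ge0 ?expR_ge1Dx.
Qed.

Lemma exprn_mul_expRN_decr n c a x : 0 < a <= x -> n%:R <= c * a ->
  x ^+ n * expR (- (c * x)) <= a ^+ n * expR (- (c * a)).
Proof.
move=> /andP[a0 ax] le_nca.
have x_le : x <= a * expR ((x - a) / a).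
  apply: (@le_trans _ _ (a * (1 + (x - a) / a))); last by rewrite ler_pM2l ?expR_ge1Dx.
  by rewrite mulrDr mulr1 mulrC divfK ?gt_eqF// addrC subrK.
apply: (@le_trans _ _ ((a * expR ((x - a) / a)) ^+ n * expR (- (c * x)))).
  by rewrite ler_pM2r ?expR_gt0// lerXn2r ?nnegrE ?mulr_ge0 ?expR_ge0//; lra.
rewrite exprMn -expRM_natl -mulrA -expRD ler_pM2l ?exprn_gt0// ler_expR.
have : n%:R * ((x - a) / a) <= c * (x - a).
  by rewrite mulrCA mulrC ler_wpM2r ?subr_ge0// ler_pdivrMr.
lra.
Qed.

Lemma sum_natr_sqr n :
  \sum_(0 <= r < n) (r%:R : R) ^+ 2 = n%:R * (n%:R - 1) * (2 * n%:R - 1) / 6.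
Proof.
elim: n => [|n IH]; first by rewrite big_geq// !mul0r.
by rewrite big_nat_recr//= IH -natr1; field.
Qed.

Lemma sum_cos_arith n x t :
  2 * sin t * \sum_(0 <= r < n) cos (x + 2 * r%:R * t) =
  sin (x + (2 * n%:R - 1) * t) - sin (x - t).
Proof.
elim: n => [|n IH]; first by rewrite big_geq// !mulr0 sub0r mulN1r subrr.
rewrite big_nat_recr//= mulrDr IH -[n.+1%:R]natr1.
have -> : x + (2 * (n%:R + 1) - 1) * t = x + 2 * n%:R * t + t by ring.
have -> : x + (2 * n%:R - 1) * t = x + 2 * n%:R * t - t by ring.
by rewrite sinB [sin (_ + t)]sinD; ring.
Qed.

Definition dirichlet n t : R := \sum_(0 <= r < n) cos (2 * r%:R * t).

Lemma dirichletE n t : sin t != 0 ->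
  dirichlet n t = (sin ((2 * n%:R - 1) * t) / sin t + 1) / 2.
Proof.
move=> s0; apply: (@mulfI _ (2 * sin t)); first by rewrite mulf_neq0 ?pnatr_eq0.
have := sum_cos_arith n 0 t; under eq_bigr => r _ do rewrite add0r.
by rewrite add0r sub0r sinN -/(dirichlet n t) => ->; field.
Qed.

Lemma dirichlet_le n t x : 0 < x <= sin t -> dirichlet n t <= (x^-1 + 1) / 2.
Proof.
move=> /andP[x0 xt]; have s0 : 0 < sin t by exact: lt_le_trans xt.
rewrite dirichletE ?gt_eqF//.
suff : sin ((2 * n%:R - 1) * t) / sin t <= x^-1 by lra.
apply: (@le_trans _ _ (sin t)^-1); last by rewrite lef_pV2.
by rewrite ler_piMl ?invr_ge0 ?sin_le1// ltW.
Qed.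

Lemma dirichlet_ge_quadratic n t :
  n%:R * (1 - (n%:R - 1) * (2 * n%:R - 1) / 3 * sin t ^+ 2) <= dirichlet n t.
Proof.
have -> : n%:R * (1 - (n%:R - 1) * (2 * n%:R - 1) / 3 * sin t ^+ 2) =
    \sum_(0 <= r < n) (1 - 2 * (r%:R ^+ 2 * sin t ^+ 2)).
  by rewrite sumrB sumr_const_nat subn0 -mulr_sumr -mulr_suml sum_natr_sqr; field.
apply: ler_sum => r _.
rewrite -[2 * r%:R * t]mulrA cos_mul2 -exprMn.
have : sin (r%:R * t) ^+ 2 <= (r%:R * sin t) ^+ 2.
  rewrite -ler_sqrt ?sqr_ge0// !sqrtr_sqr normrM ger0_norm//.
  exact: norm_sin_natmul_le.
lra.
Qed.

(* For [(2 n - 1) |sin t| <= 2] the quadratic bound is nonnegative; otherwise the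
   closed form is at least [(1 - 1 / |sin t|) / 2]. *)
Lemma dirichlet_ge n t : - (n%:R / 2) <= dirichlet n t.
Proof.
case: n => [|n]; first by rewrite /dirichlet big_geq// mul0r oppr0.
set q : R := 2 * n.+1%:R - 1.
have q1 : 1 <= q by have := ler0n R n; rewrite /q -natr1; lra.
have [small|large] := leP (q * `|sin t|) 2.
- apply: (@le_trans _ _ 0); first by rewrite oppr_le0 divr_ge0.
  apply: le_trans (dirichlet_ge_quadratic n.+1 t).
  have -> : n.+1%:R - 1 = (q - 1) / 2 by rewrite /q; lra.
  rewrite -/q mulr_ge0// subr_ge0 -(real_normK (num_real (sin t))).
  have : (q * `|sin t|) ^+ 2 <= 2 ^+ 2 by rewrite lerXn2r ?nnegrE ?mulr_ge0//; lra.
  have : 0 <= q * `|sin t| ^+ 2 by rewrite mulr_ge0 ?sqr_ge0//; lra.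
  lra.
- have s0 : 0 < `|sin t|.
    by rewrite normr_gt0; apply: contraL large => /eqP ->; rewrite normr0 mulr0 -leNgt.
  rewrite dirichletE -?normr_gt0// -/q.
  have : `|sin (q * t) / sin t| <= q / 2.
    by rewrite normrM normfV ler_pdivrMr//; have := sin_max (q * t); lra.
  by rewrite ler_norml => /andP[+ _]; rewrite /q; lra.
Qed.

End SineCosineExponential.

Lemma coef_mul1DXn (A : nzRingType) (p : {poly A}) r j :
  (p * (1 + 'X^r))`_j = p`_j + (if (j < r)%N then 0 else p`_(j - r)).
Proof. by rewrite mulrDr mulr1 coefD coefMXn. Qed.

Lemma size_1DXn r : size (1 + 'X^r : {poly int}) = r.+1.
Proof.
case: r => [|r]; first by rewrite expr0 -polyCD size_polyC.
by rewrite addrC size_polyDl size_polyXn// size_poly1.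
Qed.

Definition distinct_gf (s : seq nat) : {poly int} := \prod_(r <- s) (1 + 'X^r).

Lemma distinct_gf_cons r s : distinct_gf (r :: s) = distinct_gf s * (1 + 'X^r).
Proof. by rewrite /distinct_gf big_cons mulrC. Qed.

Lemma size_distinct_gf s : size (distinct_gf s) = (sumn s).+1.
Proof.
elim: s => [|r s IH]; first by rewrite /distinct_gf big_nil size_poly1.
have gf_neq0 : distinct_gf s != 0 by rewrite -size_poly_gt0 IH.
have fac_neq0 : 1 + 'X^r != 0 :> {poly int} by rewrite -size_poly_gt0 size_1DXn.
by rewrite distinct_gf_cons size_mul// IH size_1DXn addnS addSn addnC.
Qed.

Lemma distinct_gf_coef_gt s j : (sumn s < j)%N -> (distinct_gf s)`_j = 0.
Proof. by move=> lt_j; rewrite nth_default// size_distinct_gf. Qed.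

Lemma distinct_gf_coef_ge0 s j : 0 <= (distinct_gf s)`_j.
Proof.
elim: s j => [|r s IH] j; first by rewrite /distinct_gf big_nil coef1 ler0n.
by rewrite distinct_gf_cons coef_mul1DXn; case: ifP => _; rewrite addr_ge0.
Qed.

Lemma distinct_gf_coef_sym s j : (j <= sumn s)%N ->
  (distinct_gf s)`_(sumn s - j) = (distinct_gf s)`_j.
Proof.
elim: s j => [|r s IH] j /= le_j; first by move: le_j; rewrite leqn0 => /eqP ->.
rewrite distinct_gf_cons !coef_mul1DXn [RHS]addrC; congr (_ + _).
- case: ltnP => ?; first by rewrite distinct_gf_coef_gt//; lia.
  by rewrite -IH; [congr (_`_ _)|]; lia.
- case: ltnP => ?; first by rewrite distinct_gf_coef_gt//; lia.
  by rewrite -[RHS]IH; [congr (_`_ _)|]; lia.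
Qed.

Section FourierInversion.
Variable R : realType.
Implicit Types (t : R) (s : seq nat) (a i j l n mu M : nat).

Lemma sum_coef_mul1DXn (p : {poly int}) (N r : nat) (g : nat -> R) :
  (size p <= N.+1)%N ->
  \sum_(0 <= j < (r + N).+1) ((p * (1 + 'X^r))`_j)%:~R * g j =
  \sum_(0 <= j < N.+1) (p`_j)%:~R * (g j + g (j + r)%N).
Proof.
move=> size_p.
under eq_bigr => j _ do rewrite coef_mul1DXn rmorphD/= mulrDl.
under [RHS]eq_bigr => j _ do rewrite mulrDr.
rewrite !big_split/=; congr (_ + _).
- rewrite (@big_cat_nat _ _ _ N.+1)//= ?ltnS ?leq_addl//.
  rewrite [X in _ + X]big_nat [X in _ + X]big1 ?addr0// => j /andP[Nj _].
  by rewrite nth_default ?mul0r// (leq_trans size_p).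
- rewrite (@big_cat_nat _ _ _ r)//= ?leqW ?leq_addr//.
  rewrite [X in X + _]big_nat [X in X + _]big1 ?add0r; last first.
    by move=> j /andP[_ ->]; rewrite mul0r.
  rewrite -{1}[r]add0n big_addn -addnS addKn; apply: eq_bigr => j _.
  by rewrite ltnNge leq_addl/= addnK.
Qed.

Definition cos_prod s t : R := \prod_(r <- s) cos (r%:R * t).

Lemma cos_prodN s t : cos_prod s (- t) = cos_prod s t.
Proof. by apply: eq_bigr => r _; rewrite mulrN cosN. Qed.

Lemma sum_distinct_gf_cos s t :
  \sum_(0 <= j < (sumn s).+1)
    ((distinct_gf s)`_j)%:~R * cos ((2 * j%:R - (sumn s)%:R) * t) =
  2 ^+ size s * cos_prod s t.
Proof.
rewrite /cos_prod; elim: s => [|r s IH].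
  rewrite big_nat1 big_nil /distinct_gf big_nil coef1 /=.
  by rewrite mulr0 subrr mul0r cos0.
rewrite big_cons distinct_gf_cons sum_coef_mul1DXn ?size_distinct_gf//.
rewrite [size (r :: s)]/= exprS [RHS]mulrACA -IH mulr_sumr.
apply: eq_bigr => j _; rewrite [sumn (r :: s)]/= !natrD.
have -> : (2 * j%:R - (r%:R + (sumn s)%:R)) * t =
  (2 * j%:R - (sumn s)%:R) * t - r%:R * t by ring.
have -> : (2 * (j%:R + r%:R) - (r%:R + (sumn s)%:R)) * t =
  (2 * j%:R - (sumn s)%:R) * t + r%:R * t by ring.
by rewrite cosB cosD; ring.
Qed.

Definition grid M a : R := pi * (a%:R / M%:R) - pi / 2.

Lemma grid_bounds M a : (a < M)%N -> - (pi / 2) <= grid M a <= pi / 2.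
Proof.
move=> aM; have pi0 := pi_gt0 R.
have M0 : 0 < M%:R :> R by rewrite ltr0n (leq_ltn_trans _ aM).
have quot0 : 0 <= a%:R / M%:R :> R by rewrite divr_ge0.
have quot1 : a%:R / M%:R <= 1 :> R by rewrite ler_pdivrMr// mul1r ler_nat ltnW.
by rewrite /grid; apply/andP; split; nra.
Qed.

Lemma grid_window (s A a : nat) : (0 < s)%N -> (0 < A)%N ->
  (2 * s * A + A <= a <= 2 * s * A + 2 * A)%N ->
  pi / (4 * s%:R) <= grid (4 * s * A) a <= pi / (2 * s%:R).
Proof.
rewrite -2!(ltr_nat R) => s0 A0 /andP[a_lo a_hi].
have step0 : 0 < pi / (4 * s%:R) :> R by rewrite divr_gt0 ?mulr_gt0 ?pi_gt0.
have -> : grid (4 * s * A) a = pi / (4 * s%:R) * ((a%:R - 2 * s%:R * A%:R) / A%:R).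
  by rewrite /grid !natrM; move: pi => p; field; rewrite !gt_eqF.
have -> : pi / (2 * s%:R) = pi / (4 * s%:R) * 2 :> R.
  by move: pi => p; field; rewrite gt_eqF.
rewrite -{1}[pi / _]mulr1 !ler_pM2l// ler_pdivlMr// ler_pdivrMr//.
by rewrite lerBrDl lerBlDl mul1r -!natrM -!natrD !ler_nat a_lo.
Qed.

Lemma sum_cos_grid_eq0 M l : (0 < l < M)%N ->
  \sum_(0 <= a < M) cos (2 * l%:R * grid M a) = 0.
Proof.
move=> /andP[l0 lM].
have M0 : 0 < M%:R :> R by rewrite ltr0n (ltn_trans l0).
set h : R := l%:R * pi / M%:R.
have sin_h : 0 < sin h.
  apply: sin_gt0_pi; apply/andP; split.
    by rewrite divr_gt0// mulr_gt0 ?pi_gt0 ?ltr0n//.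
  by rewrite ltr_pdivrMr// mulrC ltr_pM2l ?pi_gt0// ltr_nat.
apply: (@mulfI _ (2 * sin h)); first by rewrite gt_eqF ?mulr_gt0.
have gridE a : 2 * l%:R * grid M a = - (l%:R * pi) + 2 * a%:R * h.
  by rewrite /grid /h; move: pi => p; field; rewrite gt_eqF.
under eq_bigr => a _ do rewrite gridE.
rewrite sum_cos_arith mulr0.
have -> : - (l%:R * pi) + (2 * M%:R - 1) * h = - (l%:R * pi) - h + 2 * l%:R * pi.
  by rewrite /h; move: pi => p; field; rewrite gt_eqF.
by rewrite sinD_natmul_2pi subrr.
Qed.

Lemma sum_cos_grid_sub M i j : (i < M)%N -> (j < M)%N ->
  \sum_(0 <= a < M) cos (2 * (i%:R - j%:R) * grid M a) = M%:R *+ (i == j).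
Proof.
move=> iM jM; case: ltngtP => [ij|ji|->].
- rewrite -[RHS](@sum_cos_grid_eq0 M (j - i)); last by lia.
  apply: eq_bigr => a _; rewrite -[RHS]cosN natrB 1?ltnW//; congr cos; ring.
- rewrite -[RHS](@sum_cos_grid_eq0 M (i - j)); last by lia.
  by apply: eq_bigr => a _; rewrite natrB 1?ltnW.
- under eq_bigr => a _ do rewrite subrr mulr0 mul0r cos0.
  by rewrite sumr_const_nat subn0.
Qed.

Lemma distinct_gf_coef_grid s M n : (sumn s < M)%N -> (n <= sumn s)%N ->
  M%:R * ((distinct_gf s)`_n)%:~R = \sum_(0 <= a < M)
    2 ^+ size s * cos_prod s (grid M a) * cos ((2 * n%:R - (sumn s)%:R) * grid M a).
Proof.
set N := sumn s => NM nN.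
pose c j : R := ((distinct_gf s)`_j)%:~R.
pose corr i j : R := \sum_(0 <= a < M) cos (2 * (i%:R - j%:R) * grid M a).
have pick i : (i <= N)%N -> \sum_(0 <= j < N.+1) c j / 2 * corr j i = c i / 2 * M%:R.
  move=> iN; rewrite (@bigD1_seq _ _ _ _ _ i) ?mem_index_iota ?iota_uniq//=.
  rewrite /corr sum_cos_grid_sub ?(leq_ltn_trans iN)// eqxx mulr1n.
  rewrite big_nat_cond big1 ?addr0// => j /andP[/andP[_ jN] ji].
  by rewrite sum_cos_grid_sub ?(leq_ltn_trans _ NM)// (negPf ji) mulr0.
transitivity (\sum_(0 <= j < N.+1) c j / 2 * (corr j n + corr j (N - n)%N)).
  under eq_bigr => j _ do rewrite mulrDr.
  rewrite big_split/= !pick ?leq_subr// [c (N - n)%N]/c distinct_gf_coef_sym//.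
  by rewrite -/(c n); field.
under [RHS]eq_bigr => a _ do rewrite -sum_distinct_gf_cos mulr_suml.
rewrite exchange_big/=; apply: eq_bigr => j _.
rewrite /corr -big_split/= mulr_sumr; apply: eq_bigr => a _.
rewrite natrB// -/N -/(c j); set t := grid M a.
have -> : 2 * (j%:R - n%:R) * t =
  (2 * j%:R - N%:R) * t - (2 * n%:R - N%:R) * t by ring.
have -> : 2 * (j%:R - (N%:R - n%:R)) * t =
  (2 * j%:R - N%:R) * t + (2 * n%:R - N%:R) * t by ring.
by rewrite cosB cosD; field.
Qed.

Definition coef_diff_kernel s mu t : R :=
  cos_prod s t * sin (mu%:R * t) * sin t.

Lemma coef_diff_kernelN s mu t :
  coef_diff_kernel s mu (- t) = coef_diff_kernel s mu t.
Proof. by rewrite /coef_diff_kernel cos_prodN mulrN !sinN -mulrA mulrNN mulrA. Qed.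

Lemma distinct_gf_coef_diff_grid s M n mu : (sumn s < M)%N ->
  (mu + 2 * n.+1 = (sumn s).+1)%N ->
  M%:R * ((distinct_gf s)`_n.+1 - (distinct_gf s)`_n)%:~R =
  2 ^+ (size s).+1 * \sum_(0 <= a < M) coef_diff_kernel s mu (grid M a).
Proof.
move=> NM mu_n; rewrite rmorphB/= mulrBr !distinct_gf_coef_grid//; try lia.
rewrite -sumrB mulr_sumr; apply: eq_bigr => a _; rewrite /coef_diff_kernel.
set t := grid M a.
have NE : (sumn s)%:R = mu%:R + 2 * n.+1%:R - 1 :> R.
  by rewrite -natrM -natrD mu_n -natr1; ring.
have -> : (2 * n.+1%:R - (sumn s)%:R) * t = t - mu%:R * t by rewrite NE; ring.
have -> : (2 * n%:R - (sumn s)%:R) * t = - (t + mu%:R * t).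
  by rewrite NE -[n.+1%:R]natr1; ring.
by rewrite cosN cosB cosD exprS; ring.
Qed.

Lemma sum_nat_ge_window (f : nat -> R) M (b c : nat) (v e : R) :
  (b <= c <= M)%N -> 0 <= e ->
  (forall a, (a < M)%N -> - e <= f a) -> (forall a, (b <= a < c)%N -> v <= f a) ->
  v *+ (c - b) - e *+ M <= \sum_(0 <= a < M) f a.
Proof.
move=> /andP[bc cM] e0 f_ge f_win.
have -> : \sum_(0 <= a < M) f a = \sum_(0 <= a < M) (f a + e) - e *+ M.
  by rewrite big_split/= sumr_const_nat subn0 addrK.
rewrite lerD2r (@big_cat_nat _ _ _ b) ?(leq_trans bc)//=.
rewrite [X in _ + X](@big_cat_nat _ _ _ c)//=.
have sum_ge0 i j : (j <= M)%N -> 0 <= \sum_(i <= a < j) (f a + e).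
  move=> jM; rewrite big_nat sumr_ge0// => a /andP[_ aj].
  by have := f_ge a (leq_trans aj jM); lra.
have : v *+ (c - b) <= \sum_(b <= a < c) (f a + e).
  rewrite -sumr_const_nat; apply: ler_sum_nat => a /f_win; lra.
by have := sum_ge0 0%N b (leq_trans bc cM); have := sum_ge0 c M (leqnn M); lra.
Qed.

(* Among [M = 4 s A] grid points, [A] lie in the window, so that the gain [A * v]
   balances the possible loss [M * (v / (4 s))]. *)
Lemma distinct_gf_coef_le rs n mu (s : nat) (v : R) : (0 < s)%N -> 0 <= v ->
  (mu + 2 * n.+1 = (sumn rs).+1)%N ->
  (forall t, 0 <= t <= pi / 2 -> - (v / (4 * s%:R)) <= coef_diff_kernel rs mu t) ->
  (forall t, pi / (4 * s%:R) <= t <= pi / (2 * s%:R) -> v <= coef_diff_kernel rs mu t) ->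
  (distinct_gf rs)`_n <= (distinct_gf rs)`_n.+1.
Proof.
move=> s0 v0 mu_n ker_ge ker_win.
set A := (sumn rs).+1; pose M := (4 * s * A)%N.
have NM : (sumn rs < M)%N by rewrite /M /A; nia.
have s_neq0 : s%:R != 0 :> R by rewrite pnatr_eq0 -lt0n.
suff ker_sum : 0 <= \sum_(0 <= a < M) coef_diff_kernel rs mu (grid M a).
  have : 0 <= M%:R * ((distinct_gf rs)`_n.+1 - (distinct_gf rs)`_n)%:~R :> R.
    by rewrite (distinct_gf_coef_diff_grid NM mu_n) mulr_ge0 ?exprn_ge0.
  by rewrite pmulr_rge0 ?ltr0n ?(leq_ltn_trans _ NM)// ler0z subr_ge0.
have gain_eq_loss : v *+ (2 * s * A + 2 * A - (2 * s * A + A)) = v / (4 * s%:R) *+ M.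
  have -> : (2 * s * A + 2 * A - (2 * s * A + A) = A)%N by lia.
  by rewrite -[v *+ A]mulr_natr -[_ *+ M]mulr_natr /M !natrM; field.
rewrite -[leLHS](subrr (v / (4 * s%:R) *+ M)) -{1}gain_eq_loss.
apply: sum_nat_ge_window.
- by rewrite /M; nia.
- by rewrite divr_ge0 ?mulr_ge0.
- move=> a /grid_bounds/andP[t_lo t_hi].
  have [t0|t0] := leP 0 (grid M a); first by rewrite ker_ge// t0.
  by rewrite -coef_diff_kernelN ker_ge//; lra.
- by move=> a /andP[a_lo /ltnW a_hi]; rewrite ker_win// grid_window// a_lo.
Qed.

End FourierInversion.

Definition parts (k m : nat) : seq nat :=
  [seq (k * j + i)%N | j <- index_iota 0 m.+1, i <- index_iota 1 k].

Lemma D_parts k m : D k m = distinct_gf (parts k m).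
Proof. by rewrite /D /distinct_gf /parts big_allpairs_dep. Qed.

Lemma size_parts k m : size (parts k m) = (k.-1 * m.+1)%N.
Proof. by rewrite size_allpairs !size_iota subn0 subn1 mulnC. Qed.

Lemma parts_lt k m r : r \in parts k m -> (r < k * m.+1)%N.
Proof.
move=> /allpairsP[[j i]/=]; rewrite !mem_index_iota => -[/andP[_ jm] /andP[_ ik] ->].
by nia.
Qed.

Lemma sum_parts (V : zmodType) (F : nat -> V) k m : (0 < k)%N ->
  \sum_(r <- parts k m) F r =
  \sum_(0 <= r < k * m.+1) F r - \sum_(0 <= j < m.+1) F (k * j)%N.
Proof.
move=> k0; rewrite big_allpairs_dep/=.
have block (j : nat) :
    \sum_(1 <= i < k) F (k * j + i)%N = \sum_(k * j <= r < k * j.+1) F r - F (k * j)%N.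
  have -> : \sum_(k * j <= r < k * j.+1) F r = \sum_(0 <= i < k) F (i + k * j)%N.
    by rewrite -{1}[(k * j)%N]add0n mulnS big_addn addnK.
  rewrite (big_ltn k0) add0n addrC addKr.
  by apply: eq_bigr => i _; rewrite addnC.
under eq_bigr => j _ do rewrite block.
rewrite sumrB; congr (_ - _).
elim: m => [|m IH]; first by rewrite big_nat1 muln0.
by rewrite big_nat_recr//= IH -big_cat_nat//= leq_mul2l leqnSn orbT.
Qed.

Lemma sumn_parts k m : (0 < k)%N -> (2 * sumn (parts k m) = k * k.-1 * m.+1 ^ 2)%N.
Proof.
move=> k0; have := size_D m k0; rewrite D_parts size_distinct_gf => -[->].
rewrite mulnC divnK// dvdn_mulr// dvdn2 oddM.
by case: k k0 => //= k _; rewrite andNb.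
Qed.

Section CosineProducts.
Variable R : realType.
Implicit Types (t : R) (s : seq nat) (k m : nat).

Definition sumsq s : R := \sum_(r <- s) r%:R ^+ 2.

Lemma sumsq_ge0 s : 0 <= sumsq s.
Proof. by apply: sumr_ge0 => r _; exact: sqr_ge0. Qed.

Lemma sumsq_parts k m : (0 < k)%N ->
  sumsq (parts k m) =
  k%:R * (k%:R - 1) * m.+1%:R * (2 * k%:R * m.+1%:R ^+ 2 - 1) / 6.
Proof.
move=> k0; rewrite /sumsq sum_parts// sum_natr_sqr.
under eq_bigr => j _ do rewrite natrM exprMn.
by rewrite -mulr_sumr sum_natr_sqr natrM; field.
Qed.

Lemma sumsq_parts_le k m : (0 < k)%N ->
  sumsq (parts k m) <= k%:R ^+ 2 * (k%:R - 1) * m.+1%:R ^+ 3 / 3.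
Proof.
move=> k0; rewrite sumsq_parts//.
have : 0 <= k%:R * (k%:R - 1) * m.+1%:R :> R by rewrite !mulr_ge0// subr_ge0 ler1n.
lra.
Qed.

Lemma sumsq_parts_ge k m : (0 < k)%N -> (8 <= k * m.+1 ^ 2)%N ->
  14 / 45 * (k%:R ^+ 2 * (k%:R - 1) * m.+1%:R ^+ 3) <= sumsq (parts k m).
Proof.
move=> k0; rewrite -(ler_nat R) natrM natrX sumsq_parts// => kL8.
have v0 : 0 <= k%:R * (k%:R - 1) * m.+1%:R :> R by rewrite !mulr_ge0// subr_ge0 ler1n.
have := ler_wpM2l v0 kL8; lra.
Qed.

Lemma norm_cos_prod_le s t :
  `|cos_prod s t| <= expR (- ((\sum_(r <- s) sin (r%:R * t) ^+ 2) / 2)).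
Proof.
rewrite /cos_prod normr_prod mulr_suml -sumrN expR_sum.
by apply: ler_prod => r _; rewrite normr_ge0 norm_cos_le_expR.
Qed.

Lemma cos_prod_ge0 s t : 0 <= t -> {in s, forall r, r%:R * t <= pi / 2} ->
  0 <= cos_prod s t.
Proof.
move=> t0 le_rt; rewrite /cos_prod big_seq prodr_ge0// => r /le_rt rt.
have pi0 := pi_gt0 R; apply: cos_ge0_pihalf; rewrite rt andbT.
by rewrite (@le_trans _ _ 0) ?mulr_ge0// oppr_le0 divr_ge0// ltW.
Qed.

Lemma cos_prod_le_gauss s t : 0 <= t -> {in s, forall r, r%:R * t <= pi / 2} ->
  cos_prod s t <= expR (- (sumsq s * t ^+ 2 / 2)).
Proof.
move=> t0 le_rt; have pi0 := pi_gt0 R.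
rewrite /cos_prod /sumsq -mulrA mulr_suml -sumrN expR_sum.
rewrite big_seq [leRHS]big_seq; apply: ler_prod => r /le_rt rt.
have rt0 : 0 <= r%:R * t by rewrite mulr_ge0.
apply/andP; split; first by apply: cos_ge0_pihalf; lra.
by rewrite mulrA -exprMn; apply: cos_le_gauss; lra.
Qed.

Lemma cos_prod_ge s t : sumsq s * t ^+ 2 <= 1 ->
  1 - sumsq s * t ^+ 2 / 2 <= cos_prod s t.
Proof.
elim: s => [|r s IH]; first by rewrite /sumsq /cos_prod !big_nil; lra.
rewrite /sumsq /cos_prod !big_cons -/(sumsq s) -/(cos_prod s t) => le1.
have rt_cos := @cos_ge_quadratic R (r%:R * t); rewrite exprMn in rt_cos.
have st0 : 0 <= sumsq s * t ^+ 2 by rewrite mulr_ge0 ?sumsq_ge0 ?sqr_ge0.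
have rt0 : 0 <= r%:R ^+ 2 * t ^+ 2 by rewrite mulr_ge0 ?sqr_ge0.
have IHs : 1 - sumsq s * t ^+ 2 / 2 <= cos_prod s t by apply: IH; lra.
have : (1 - r%:R ^+ 2 * t ^+ 2 / 2) * (1 - sumsq s * t ^+ 2 / 2) <=
    cos (r%:R * t) * cos_prod s t by apply: ler_pM => //; lra.
by have := mulr_ge0 rt0 st0; lra.
Qed.

Lemma sum_sin_sqr_parts k m t : (0 < k)%N ->
  \sum_(r <- parts k m) sin (r%:R * t) ^+ 2 =
  ((k%:R - 1) * m.+1%:R - dirichlet (k * m.+1) t + dirichlet m.+1 (k%:R * t)) / 2.
Proof.
move=> k0.
transitivity (\sum_(r <- parts k m) (1 - cos (2 * r%:R * t)) / 2).
  by apply: eq_bigr => r _; rewrite -[2 * r%:R * t]mulrA cos_mul2; field.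
rewrite -mulr_suml sumrB big_const_seq count_predT size_parts iter_addr_0 sum_parts//.
rewrite natrM -subn1 natrB// -/(dirichlet _ _) opprB [X in _ + X]addrC addrA; congr (_ / _).
congr (_ + _); apply: eq_bigr => j _.
by rewrite natrM; congr cos; ring.
Qed.

End CosineProducts.

Section KernelEstimates.
Variable R : realType.
Implicit Types (t : R) (s : seq nat) (k m mu : nat).

Lemma norm_coef_diff_kernel_le s mu t :
  `|coef_diff_kernel s mu t| <= `|cos_prod s t| * (mu%:R * sin t ^+ 2).
Proof.
rewrite /coef_diff_kernel -mulrA normrM ler_wpM2l// normrM -(real_normK (num_real (sin t))).
by rewrite expr2 mulrA ler_wpM2r// norm_sin_natmul_le.
Qed.

Lemma coef_diff_kernel_ge_near0 s mu t (c : R) :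
  4 <= c -> 2 * mu%:R <= c -> 4 * sumsq R s <= c ^+ 2 ->
  pi / (4 * c) <= t <= pi / (2 * c) ->
  mu%:R / (8 * c ^+ 2) <= coef_diff_kernel s mu t.
Proof.
move=> c4 mu_c sumsq_c /andP[t_lo t_hi].
have c0 : 0 < c by lra.
have [pi3 pi4] := (pi_ge3 R, pihalf_lt2 R).
set u := c^-1; have u0 : 0 < u by rewrite invr_gt0.
have uc : u * c = 1 by rewrite mulVf ?gt_eqF.
have {}t_lo : 3 / 4 * u <= t.
  apply: le_trans t_lo; rewrite invfM mulrA -/u ler_wpM2r ?(ltW u0)//; lra.
have {}t_hi : t <= 2 * u.
  apply: (le_trans t_hi); rewrite invfM mulrA -/u ler_wpM2r ?(ltW u0)//; lra.
have t01 : 0 <= t <= 1 by apply/andP; split; nra.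
have mu0 : 0 <= mu%:R :> R by [].
have mut01 : 0 <= mu%:R * t <= 1 by apply/andP; split; nra.
have cos_half : 1 / 2 <= cos_prod s t.
  have sumsq_t : sumsq R s * t ^+ 2 <= 1.
    have -> : 1 = c ^+ 2 / 4 * (2 * u) ^+ 2 by rewrite /u; field; rewrite gt_eqF.
    apply: ler_pM; [exact: sumsq_ge0|exact: sqr_ge0|lra|].
    by rewrite lerXn2r ?nnegrE//; lra.
  by have := cos_prod_ge sumsq_t; lra.
have sin_mut : 5 / 8 * (mu%:R * u) <= sin (mu%:R * t).
  by apply: le_trans (sin_ge_linear mut01); have := ler_wpM2l mu0 t_lo; lra.
have sin_t : 5 / 8 * u <= sin t by apply: le_trans (sin_ge_linear t01); lra.
have muu0 : 0 <= mu%:R * u by rewrite mulr_ge0// ltW.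
apply: (@le_trans _ _ (1 / 2 * (5 / 8 * (mu%:R * u)) * (5 / 8 * u))).
  by rewrite invfM -exprVn -/u; have := mulr_ge0 muu0 (ltW u0); lra.
by apply: ler_pM => //; [lra|lra|apply: ler_pM => //; lra].
Qed.

Lemma norm_cos_prod_parts_far k m t : (5 <= k)%N -> (12 <= m)%N ->
  3 / 2 <= (k * m.+1)%:R * t -> t <= pi / 2 ->
  `|cos_prod (parts k m) t| <= expR (- ((k%:R - 1) * m.+1%:R / 9)).
Proof.
move=> k5 m12 yt_ge t_le; set L : R := m.+1%:R; set y : R := (k * m.+1)%:R in yt_ge.
have kR : 5 <= k%:R :> R by rewrite ler_nat.
have LR : 13 <= L by rewrite ler_nat.
have yE : y = k%:R * L by rewrite /y natrM.
have y0 : 65 <= y by rewrite yE; nra.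
set u := y^-1; have u0 : 0 < u by rewrite invr_gt0; lra.
have uy : u * y = 1 by rewrite mulVf// gt_eqF//; lra.
have dirichlet_all : dirichlet (k * m.+1) t <= (100 / 149 * y + 1) / 2.
  have -> : 100 / 149 * y = (149 / 100 * u)^-1 by rewrite invfM invrK invf_div.
  apply: dirichlet_le; rewrite mulr_gt0 ?divr_gt0//=.
  apply: (@le_trans _ _ (3 / 2 * u - (3 / 2 * u) ^+ 3 / 6)).
    have u_le : u <= 1 / 65 by nra.
    have : 0 <= u * ((1 / 65) ^+ 2 - u ^+ 2).
      by rewrite mulr_ge0 ?(ltW u0)// subr_ge0 lerXn2r ?nnegrE ?(ltW u0)//; lra.
    lra.
  apply: sin_ge_cubic_of_le => //; apply/andP; split; first by lra.
  by rewrite ler_pdivrMr ?[t * y]mulrC//; lra.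
have dirichlet_mul := dirichlet_ge m.+1 (k%:R * t); rewrite -/L in dirichlet_mul.
apply: (le_trans (norm_cos_prod_le _ _)); rewrite ler_expR lerN2.
rewrite sum_sin_sqr_parts ?(leq_trans _ k5)// -/L.
by rewrite yE in dirichlet_all; nra.
Qed.

Lemma gauss_exponent_parts_ge k m t : (1 < k)%N -> (8 <= k * m.+1 ^ 2)%N ->
  3 <= k%:R * (k%:R - 1) * m.+1%:R * t ->
  7 / 5 * (m.+1%:R / (k%:R - 1)) <= sumsq R (parts k m) * t ^+ 2 / 2.
Proof.
move=> k1 kL8; set L : R := m.+1%:R; set v := k%:R * (k%:R - 1) * L => vt_ge.
have kR : 1 < k%:R :> R by rewrite ltr1n.
have L0 : 0 < L by rewrite ltr0n.
have v0 : 0 < v by rewrite !mulr_gt0//; lra.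
have := @sumsq_parts_ge R k m (ltnW k1) kL8; rewrite -/L => sumsq_ge.
have -> : L / (k%:R - 1) = 3 ^+ 2 * (k%:R * L ^+ 2 / (9 * v)).
  by rewrite /v; clearbody L; field; rewrite !gt_eqF//; lra.
have vt_sqr : 3 ^+ 2 <= (v * t) ^+ 2 by rewrite lerXn2r ?nnegrE//; lra.
have coef0 : 0 <= k%:R * L ^+ 2 / (9 * v).
  by rewrite divr_ge0 ?mulr_ge0 ?sqr_ge0 ?ltW//; lra.
have := ler_wpM2r coef0 vt_sqr.
have -> : (v * t) ^+ 2 * (k%:R * L ^+ 2 / (9 * v)) =
  k%:R ^+ 2 * (k%:R - 1) * L ^+ 3 * t ^+ 2 / 9.
  by rewrite /v; clearbody L; field; rewrite !gt_eqF//; lra.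
by have := ler_wpM2r (sqr_ge0 t) sumsq_ge; lra.
Qed.

Lemma ler_mul22_of_cubic_le (k L : R) :
  5 <= k -> 0 <= L -> 64 * k ^+ 3 <= L ^+ 2 -> 22 * (k - 1) <= L.
Proof.
move=> k5 L0 kL; rewrite -(@ler_pXn2r _ 2) ?nnegrE//; last by lra.
apply: le_trans kL; have : 0 <= (k - 5) * k ^+ 2 by rewrite mulr_ge0 ?sqr_ge0; lra.
nra.
Qed.

Lemma cube_mul_expRN_far_le1 (k L : R) : 5 <= k -> 89 <= L ->
  32 * (k * L ^+ 2) ^+ 3 * expR (- ((k - 1) * L / 9)) <= 1.
Proof.
move=> k5 L89; set P := (k - 1) * L.
have P356 : 356 <= P by rewrite /P; nra.
have kLP : k * L <= 5 / 4 * P by rewrite /P; nra.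
have LP : L <= 1 / 4 * P by rewrite /P; nra.
have decr : P ^+ 6 * expR (- (9^-1 * P)) <= 356 ^+ 6 * expR (- (9^-1 * 356)).
  by apply: exprn_mul_expRN_decr; lra.
have exp_le : expR (- (9^-1 * 356)) <= (2 / 5) ^+ 39 :> R by apply: expRN_natr_le; lra.
have scale_le : (k * L ^+ 2) ^+ 3 <= (5 / 4 * P) ^+ 3 * (1 / 4 * P) ^+ 3.
  by rewrite expr2 mulrA exprMn ler_pM ?exprn_ge0 ?lerXn2r ?nnegrE//; nra.
rewrite [P / 9]mulrC.
apply: (@le_trans _ _ (32 * ((5 / 4 * P) ^+ 3 * (1 / 4 * P) ^+ 3) * expR (- (9^-1 * P)))).
  by rewrite ler_wpM2r ?expR_ge0//; lra.
lra.
Qed.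

Lemma cube_mul_expRN_near_le1 (k L : R) : 5 <= k -> 0 <= L -> 64 * k ^+ 3 <= L ^+ 2 ->
  32 * (k * L ^+ 2) ^+ 3 * ((3 / 2 / (k * L)) ^+ 2 * expR (- (7 / 5 * (L / (k - 1))))) <= 1.
Proof.
move=> k5 L0 kL3; have kL := ler_mul22_of_cubic_le k5 L0 kL3.
set z := L / (k - 1).
have z22 : 22 <= z by rewrite /z ler_pdivlMr; lra.
have LE : L = z * (k - 1) by rewrite /z divfK// gt_eqF//; lra.
have L_le : L <= z * k by rewrite LE; nra.
have k_le : 64 * k <= z ^+ 2.
  have : L ^+ 2 <= (z * k) ^+ 2 by rewrite lerXn2r ?nnegrE//; nra.
  rewrite exprMn => L2_le.
  have : k ^+ 2 * (64 * k) <= k ^+ 2 * z ^+ 2 by lra.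
  by rewrite ler_pM2l ?exprn_gt0//; lra.
have L_le3 : 64 * L <= z ^+ 3 by rewrite exprSr; nra.
have kL4 : (64 * k) * (64 * L) ^+ 4 <= z ^+ 2 * (z ^+ 3) ^+ 4.
  by rewrite ler_pM ?exprn_ge0 ?lerXn2r ?nnegrE//; nra.
have decr : z ^+ 14 * expR (- (7 / 5 * z)) <= 22 ^+ 14 * expR (- (7 / 5 * 22)).
  by apply: exprn_mul_expRN_decr; lra.
have exp_le : expR (- (7 / 5 * 22)) <= (2 / 5) ^+ 30 :> R by apply: expRN_natr_le; lra.
have -> : 32 * (k * L ^+ 2) ^+ 3 * ((3 / 2 / (k * L)) ^+ 2 * expR (- (7 / 5 * z))) =
  72 / 64 ^+ 5 * ((64 * k) * (64 * L) ^+ 4 * expR (- (7 / 5 * z))).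
  by clearbody z; field; rewrite !gt_eqF//; lra.
have := ler_wpM2r (expR_ge0 (- (7 / 5 * z))) kL4; rewrite -exprM -exprD.
lra.
Qed.

End KernelEstimates.

Section CoefficientWindow.
Variables (R : realType) (k m : nat).
Hypotheses (k5 : (5 <= k)%N) (cubic_le : (64 * k ^ 3 <= m.+1 ^ 2)%N).
Implicit Types (t : R) (mu n : nat).

Local Notation L := (m.+1%:R : R).
(* The lower bound on the window of the summand only needs [4 * sumsq <= s ^ 2] and
   [2 * mu <= s]; this choice of [s] avoids an integer square root. *)
Local Notation s := (k * m.+1 ^ 2)%N.
Local Notation ker mu t := (@coef_diff_kernel R (parts k m) mu t).

Let k0 : (0 < k)%N.
Proof. exact: leq_trans k5. Qed.

Let cubic_leR : 64 * k%:R ^+ 3 <= L ^+ 2.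
Proof. by rewrite -!natrX -natrM ler_nat. Qed.

Let predkR : k.-1%:R = k%:R - 1 :> R.
Proof. by rewrite -subn1 natrB. Qed.

(* [89] is the integer part of [8 * 5 ^ (3 / 2)]. *)
Let L_ge89 : (89 <= m.+1)%N.
Proof.
have : (125 <= k ^ 3)%N by rewrite (@leq_exp2r 5 k 3).
by move: cubic_le; nia.
Qed.

Let scaleE : s%:R = k%:R * L ^+ 2 :> R.
Proof. by rewrite natrM natrX. Qed.

Let scale_gt0 : 0 < 32 * s%:R ^+ 3 :> R.
Proof. by rewrite mulr_gt0 ?exprn_gt0// ltr0n muln_gt0 k0. Qed.

Lemma coef_diff_kernel_parts_ge_far mu t : 3 / 2 <= (k * m.+1)%:R * t -> t <= pi / 2 ->
  - (mu%:R / (32 * s%:R ^+ 3)) <= ker mu t.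
Proof.
move=> yt_ge t_le.
have C_le : `|cos_prod (parts k m) t| <= (32 * s%:R ^+ 3)^-1.
  apply: (le_trans (norm_cos_prod_parts_far k5 _ yt_ge t_le)); first by lia.
  rewrite -[leRHS]div1r ler_pdivlMr// scaleE mulrC.
  by rewrite cube_mul_expRN_far_le1// ler_nat.
have : `|ker mu t| <= mu%:R / (32 * s%:R ^+ 3); last by rewrite ler_norml => /andP[].
apply: (le_trans (norm_coef_diff_kernel_le _ _ _)); rewrite [leRHS]mulrC ler_pM//.
  by rewrite mulr_ge0 ?sqr_ge0.
by rewrite ler_piMr// sin2cos2 gerBl sqr_ge0.
Qed.

Let parts_mul_le_pihalf t : 0 <= t -> (k * m.+1)%:R * t <= 3 / 2 ->
  {in parts k m, forall r, r%:R * t <= pi / 2}.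
Proof.
move=> t0 yt_le r /parts_lt/ltnW; rewrite -(ler_nat R) => /(ler_wpM2r t0).
by have := pi_ge3 R; lra.
Qed.

Let sin_sqr_near t : 0 <= t -> (k * m.+1)%:R * t <= 3 / 2 ->
  0 <= sin t /\ sin t ^+ 2 <= (3 / 2 / (k%:R * L)) ^+ 2.
Proof.
move=> t0; rewrite -natrM => yt_le; have pi3 := pi_ge3 R.
have y1 : 1 <= (k * m.+1)%:R :> R by rewrite ler1n muln_gt0 k0.
have y0 : 0 < (k * m.+1)%:R :> R by lra.
have sin0 : 0 <= sin t by apply: sin_ge0_pi; rewrite t0; nra.
split=> //; rewrite lerXn2r ?nnegrE ?divr_ge0//.
by apply: le_trans (sin_le t0) _; rewrite ler_pdivlMr// mulrC.
Qed.

Lemma sin_sqr_mul_cos_prod_parts_near t : 0 <= t -> (k * m.+1)%:R * t <= 3 / 2 ->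
  3 <= k%:R * (k%:R - 1) * L * t ->
  sin t ^+ 2 * cos_prod (parts k m) t <= (32 * s%:R ^+ 3)^-1.
Proof.
move=> t0 yt_le vt_ge; have rt_le := parts_mul_le_pihalf t0 yt_le.
have [_ sin_sqr_le] := sin_sqr_near t0 yt_le.
have C_le : cos_prod (parts k m) t <= expR (- (7 / 5 * (L / (k%:R - 1)))).
  apply: (le_trans (cos_prod_le_gauss t0 rt_le)); rewrite ler_expR lerN2.
  apply: gauss_exponent_parts_ge => //; first exact: leq_trans k5.
  by rewrite (@leq_trans (5 * 89 ^ 2))// leq_mul// leq_exp2r.
apply: (le_trans (ler_pM (sqr_ge0 _) (cos_prod_ge0 t0 rt_le) sin_sqr_le C_le)).
rewrite -[leRHS]div1r ler_pdivlMr// scaleE mulrC.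
by apply: cube_mul_expRN_near_le1; rewrite ?ler_nat.
Qed.

Lemma coef_diff_kernel_parts_ge_near mu t : (mu <= k * k.-1 * m.+1)%N ->
  0 <= t -> (k * m.+1)%:R * t <= 3 / 2 ->
  - (mu%:R / (32 * s%:R ^+ 3)) <= ker mu t.
Proof.
move=> mu_le t0 yt_le; have C0 := cos_prod_ge0 t0 (parts_mul_le_pihalf t0 yt_le).
have [sin0 _] := sin_sqr_near t0 yt_le.
have [mut_le|mut_gt] := leP (mu%:R * t) pi.
  apply: (@le_trans _ _ 0); first by rewrite oppr_le0 divr_ge0// ltW.
  by rewrite !mulr_ge0// sin_ge0_pi// mut_le mulr_ge0.
have vt_ge : 3 <= k%:R * (k%:R - 1) * L * t.
  have : mu%:R * t <= (k * k.-1 * m.+1)%:R * t by rewrite ler_wpM2r// ler_nat.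
  by rewrite !natrM predkR; have := pi_ge3 R; lra.
have := norm_coef_diff_kernel_le (parts k m) mu t.
rewrite (ger0_norm C0) ler_norml => /andP[+ _]; apply: le_trans.
by rewrite lerN2 mulrCA ler_wpM2l// mulrC sin_sqr_mul_cos_prod_parts_near.
Qed.

Lemma coef_diff_kernel_parts_ge_window mu t : (mu <= k * k.-1 * m.+1)%N ->
  pi / (4 * s%:R) <= t <= pi / (2 * s%:R) ->
  mu%:R / (8 * s%:R ^+ 2) <= ker mu t.
Proof.
move=> mu_le; rewrite scaleE.
have {}mu_le : mu%:R <= k%:R * (k%:R - 1) * L by rewrite -predkR -!natrM ler_nat.
have kR : 5 <= k%:R :> R by rewrite ler_nat.
have kL := ler_mul22_of_cubic_le kR (ler0n _ _) cubic_leR.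
have LR : 89 <= L by rewrite ler_nat.
apply: coef_diff_kernel_ge_near0.
- by rewrite -[4]mulr1 ler_pM ?exprn_ege1//; lra.
- apply: (@le_trans _ _ (k%:R * L * (2 * (k%:R - 1)))); first by lra.
  by rewrite expr2 mulrA ler_wpM2l ?mulr_ge0//; lra.
- have := @sumsq_parts_le R k m k0.
  have cube0 : 0 <= k%:R ^+ 2 * L ^+ 3 by rewrite mulr_ge0 ?exprn_ge0.
  have : k%:R ^+ 2 * L ^+ 3 * (4 / 3 * (k%:R - 1)) <= k%:R ^+ 2 * L ^+ 3 * L.
    by rewrite ler_wpM2l//; lra.
  lra.
Qed.

Lemma D_coef_le_window n :
  (k * k.-1 * m ^ 2 <= 4 * n.+1 <= k * k.-1 * m.+1 ^ 2)%N -> d k m n <= d k m n.+1.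
Proof.
move=> /andP[n_lo n_hi].
have sumn2 := sumn_parts m k0.
have [mu mu_n] : exists mu, (mu + 2 * n.+1 = (sumn (parts k m)).+1)%N.
  by exists ((sumn (parts k m)).+1 - 2 * n.+1)%N; lia.
have mu_le : (mu <= k * k.-1 * m.+1)%N by nia.
have s0 : (0 < s)%N by rewrite muln_gt0 k0.
rewrite /d D_parts.
apply: (@distinct_gf_coef_le R _ n mu s (mu%:R / (8 * s%:R ^+ 2))) => //.
- by rewrite divr_ge0 ?mulr_ge0 ?sqr_ge0.
- move=> t /andP[t0 t_le].
  have -> : mu%:R / (8 * s%:R ^+ 2) / (4 * s%:R) = mu%:R / (32 * s%:R ^+ 3) :> R.
    have : s%:R != 0 :> R by rewrite pnatr_eq0 -lt0n.
    by move: (s%:R : R) => c c_neq0; field.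
  have [yt_le|/ltW yt_ge] := leP ((k * m.+1)%:R * t) (3 / 2).
    exact: coef_diff_kernel_parts_ge_near.
  exact: coef_diff_kernel_parts_ge_far.
- by move=> t; exact: coef_diff_kernel_parts_ge_window.
Qed.

End CoefficientWindow.

(* [0 <= p`_0] is the step from the coefficient of index [-1], read as [0]. *)
Definition coef_nondecr_upto (h : nat) (p : {poly int}) : Prop :=
  0 <= p`_0 /\ forall i, (i < h)%N -> p`_i <= p`_i.+1.

Lemma coef_nondecr_upto_mul1DXn h p r : (0 < r)%N ->
  coef_nondecr_upto h p -> coef_nondecr_upto h (p * (1 + 'X^r)).
Proof.
move=> r0 [p0 incr]; split; first by rewrite coef_mul1DXn r0 addr0.
move=> i ih; rewrite !coef_mul1DXn; apply: lerD; first exact: incr.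
case: (ltngtP i.+1 r) => [ir|ri|ir].
- by [].
- by rewrite subSn// incr//; lia.
- by rewrite ir subnn.
Qed.

Lemma coef_nondecr_upto_mul_prod h p (I : Type) (s : seq I) (f : I -> nat) :
  (forall i, (0 < f i)%N) -> coef_nondecr_upto h p ->
  coef_nondecr_upto h (p * \prod_(i <- s) (1 + 'X^(f i))).
Proof.
move=> f0; elim: s p => [|i s IH] p hp; first by rewrite big_nil mulr1.
by rewrite big_cons mulrA; apply/IH/coef_nondecr_upto_mul1DXn.
Qed.

Lemma unimodal_palindromic (p : {poly int}) (N : nat) :
  (size p).-1 = N -> (forall j, (j <= N)%N -> p`_(N - j) = p`_j) ->
  unimodal p <-> forall i, (i < N./2)%N -> p`_i <= p`_i.+1.
Proof.
rewrite /unimodal => -> sym; split=> [[j [jN incr decr]] i ih|incr].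
  have [ij|ji] := ltnP i j; first exact: incr.
  have antitone a b : (j <= a)%N -> (a + b <= N)%N -> p`_(a + b) <= p`_a.
    move=> ja; elim: b => [|b IH] abN; first by rewrite addn0.
    by rewrite addnS; apply: le_trans (IH _); [apply: decr|]; lia.
  rewrite -(sym i); last by lia.
  have -> : (N - i = i.+1 + (N - i - i.+1))%N by lia.
  by apply: antitone; lia.
exists N./2; split=> // [|i ih]; first by lia.
rewrite -(sym i.+1) -?(sym i); try lia.
have [->|ne] := eqVneq (N - i.+1)%N i; first by rewrite sym; lia.
have -> : (N - i = (N - i.+1).+1)%N by lia.
by apply: incr; lia.
Qed.

Lemma unimodal_DE k m : (0 < k)%N ->
  unimodal (D k m) <-> coef_nondecr_upto (sumn (parts k m))./2 (D k m).
Proof.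
move=> k0; rewrite D_parts; set f := distinct_gf _.
have size_f : (size f).-1 = sumn (parts k m) by rewrite size_distinct_gf.
have [incr_of_unimodal unimodal_of_incr] :=
  unimodal_palindromic size_f (@distinct_gf_coef_sym (parts k m)).
split=> [/incr_of_unimodal incr|[_ /unimodal_of_incr //]].
by split=> //; exact: distinct_gf_coef_ge0.
Qed.

Lemma unimodal_DS k m : (0 < k)%N -> unimodal (D k m) ->
  (forall n, (k * k.-1 * m.+1 ^ 2 <= 4 * n.+1 <= k * k.-1 * m.+2 ^ 2)%N ->
    d k m.+1 n <= d k m.+1 n.+1) ->
  unimodal (D k m.+1).
Proof.
move=> k0 /(unimodal_DE _ k0) incr_m window; apply/unimodal_DE => //.
have [D0 incr] : coef_nondecr_upto (sumn (parts k m))./2 (D k m.+1).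
  by rewrite /D big_nat_recr//=; apply: coef_nondecr_upto_mul_prod => // i; lia.
split=> // n n_lt; have [n_le|n_ge] := ltnP n (sumn (parts k m))./2; first exact: incr.
by apply: window; have := sumn_parts m k0; have := sumn_parts m.+1 k0; lia.
Qed.

Lemma le_ceil_floor_divr (R : realType) (a b c n : nat) : (0 < c)%N ->
  (Num.ceil (a%:R / c%:R : R) <= n%:Z <= Num.floor (b%:R / c%:R : R)) =
  (a <= c * n <= b)%N.
Proof.
move=> c0; rewrite ceil_le_int floor_ge_int -!pmulrn.
by rewrite ler_pdivrMr ?ler_pdivlMr ?ltr0n// -!natrM !ler_nat mulnC.
Qed.

Lemma mul8_powR32_le (R : realType) (k m : nat) :
  (8 * (k%:R : R) `^ (3 / 2) <= m%:R) = (64 * k ^ 3 <= m ^ 2)%N.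
Proof.
rewrite -(@ler_pXn2r _ 2) ?nnegrE ?mulr_ge0 ?powR_ge0// exprMn.
have -> : ((k%:R : R) `^ (3 / 2)) ^+ 2 = k%:R ^+ 3.
  by rewrite -powR_mulrn ?powR_ge0// -powRrM -[RHS]powR_mulrn//; congr (_ `^ _); lra.
by rewrite -[8 ^+ 2]natrX -!natrX -natrM ler_nat.
Qed.

Theorem theorem1p2 (R : realType) (k m0 : nat) (hk : (5 <= k)%N)
  (hm0 : unimodal (D k m0))
  (hd : forall m : nat, (m0 < m)%N -> m%:R < 8 * (k%:R : R) `^ (3 / 2) ->
    forall n : nat,
      Num.ceil (k%:R * (k%:R - 1) * m%:R ^+ 2 / 4 : R) <= n%:Z
        <= Num.floor (k%:R * (k%:R - 1) * m.+1%:R ^+ 2 / 4 : R) ->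
      d k m n.-1 <= d k m n) :
  forall m : nat, (m0 <= m)%N -> unimodal (D k m).
Proof.
have k0 : (0 < k)%N by apply: leq_trans hk.
have coefE m : k%:R * (k%:R - 1) * m%:R ^+ 2 = (k * k.-1 * m ^ 2)%:R :> R.
  by rewrite natrM natrX natrM -subn1 natrB.
elim=> [|m IH]; first by rewrite leqn0 => /eqP <-.
rewrite leq_eqVlt => /predU1P[<- //|m0m]; apply: unimodal_DS => [//||n window].
  exact: IH.
have [small|] := ltP (m.+1%:R : R) (8 * k%:R `^ (3 / 2)).
  by apply: (hd m.+1 m0m small n.+1); rewrite !coefE le_ceil_floor_divr.
rewrite mul8_powR32_le => large.
by apply: (@D_coef_le_window R) => //; rewrite (leq_trans large) ?leq_exp2r.
Qed.
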